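(* Let $\mathbb{K}$ be an algebraically closed field and let $P$ and $Q$ be two points in $\mathbb{P}^2=\mathbb{P}^2_{\mathbb{K}}$. (a) If $P\in\mathbb{P}^2\setminus\Delta_1$ and $P\star Q$ is defined, then for $m=1$ and every integer $n\geq 1$ the equality $I(P)^m\star I(Q)^n=I(P\star Q)^{m+n-1}$ holds, i.e. $I(P)\star I(Q)^n=I(P\star Q)^n$. (b) If $P,Q\in\Delta_1\setminus\Delta_0$, then for integers $m,n\geq 1$ the equality $I(P)^m\star I(Q)^n=I(P\star Q)^{m+n-1}$ does not hold, except for $m=n=1$, when it does hold.
   Context: $S=\mathbb{K}[x_0,x_1,x_2]$. For a point $P\in\mathbb{P}^2$, $I(P)\subset S$ is the ideal generated by all homogeneous polynomials vanishing at $P$. $\Delta_1\subset\mathbb{P}^2$ is the union of the three coordinate lines $x_i=0$ (points with at most two nonzero coordinates), and $\Delta_0=\{[1:0:0],[0:1:0],[0:0:1]\}$. The Hadamard product of points is $[p_0:p_1:p_2]\star[q_0:q_1:q_2]=[p_0q_0:p_1q_1:p_2q_2]$, and it is defined when $p_iq_i\neq 0$ for some $i$. The Hadamard product of two ideals $I,J\subset S$ is the elimination ideal $$I\star J=\big(I(\mathbf{y})+J(\mathbf{z})+\langle x_i-y_iz_i\mid i=0,1,2\rangle\big)\cap\mathbb{K}[x_0,x_1,x_2],$$ the ideal sum being taken in $\mathbb{K}[x_0,x_1,x_2,y_0,y_1,y_2,z_0,z_1,z_2]$, where $I(\mathbf{y})$ and $J(\mathbf{z})$ are the images of $I$ and $J$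 under $x_i\mapsto y_i$ and $x_i\mapsto z_i$ respectively. *)

(* Defs.v *)
From mathcomp Require Import all_boot all_order all_algebra.
From mathcomp Require Import mpoly.

Set Implicit Arguments.
Unset Strict Implicit.
Unset Printing Implicit Defensive.

Import GRing.Theory.
Local Open Scope ring_scope.

(* Ideals are Prop-valued predicates, compared extensionally.                *)

Definition ideal_gen (R : comNzRingType) (G : R -> Prop) : R -> Prop :=
  fun f => exists2 s : seq (R * R),
    (forall ag, ag \in s -> G ag.2) & f = \sum_(ag <- s) ag.1 * ag.2.

Definition ideal_add (R : comNzRingType) (I J : R -> Prop) : R -> Prop :=
  fun f => exists g h, [/\ I g, J h & f = g + h].

Definition ideal_exp (R : comNzRingType) (I : R -> Prop) (n : nat) : R -> Prop :=
  ideal_gen (fun f => exists2 t : n.-tuple R,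
    (forall g, g \in t -> I g) & f = \prod_(g <- t) g).

Definition ideal_eq (R : comNzRingType) (I J : R -> Prop) : Prop :=
  forall f, I f <-> J f.

(* The polynomial ring in x_0, x_1, x_2, y_0, y_1, y_2, z_0, z_1, z_2, with   *)
(* the variables in this order.                                              *)
Notation Sxyz K := {mpoly K[3 + 3 + 3]}.

Definition xvar (K : fieldType) (i : 'I_3) : Sxyz K :=
  'X_(lshift 3 (lshift 3 i)).
Definition yvar (K : fieldType) (i : 'I_3) : Sxyz K :=
  'X_(lshift 3 (rshift 3 i)).
Definition zvar (K : fieldType) (i : 'I_3) : Sxyz K :=
  'X_(rshift (3 + 3) i).

Definition subst (K : fieldType) (v : 'I_3 -> Sxyz K) (f : {mpoly K[3]}) :
  Sxyz K := f \mPo [tuple v i | i < 3].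

(* The extension to K[x, y, z] of the image of I under x_i |-> v_i.          *)
Definition ideal_ext (K : fieldType) (v : 'I_3 -> Sxyz K)
    (I : {mpoly K[3]} -> Prop) : Sxyz K -> Prop :=
  ideal_gen (fun F => exists2 f, I f & F = subst v f).

Definition graph_ideal (K : fieldType) : Sxyz K -> Prop :=
  ideal_gen (fun F => exists i, F = xvar K i - yvar K i * zvar K i).

Definition ideal_hadamard (K : fieldType) (I J : {mpoly K[3]} -> Prop) :
  {mpoly K[3]} -> Prop :=
  fun f => ideal_add (ideal_add (ideal_ext (@yvar K) I) (ideal_ext (@zvar K) J))
             (@graph_ideal K) (subst (@xvar K) f).

(* Points of the projective plane are the lines through 0 in K^3; the        *)
(* nonzero v \in \val P are the homogeneous coordinate vectors of P.         *)
Definition P2 (K : fieldType) := {L : {vspace 'rV[K]_3} | \dim L == 1}.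

(* A homogeneous polynomial vanishes at P iff it vanishes on the whole line   *)
(* \val P (0 included: a nonzero constant vanishes nowhere).                 *)
Definition ideal_pt (K : fieldType) (P : P2 K) : {mpoly K[3]} -> Prop :=
  ideal_gen (fun f => (exists d, f \is d.-homog) /\
                      (forall v, v \in \val P -> f.@[v 0] = 0)).

Definition Delta1 (K : fieldType) (P : P2 K) : Prop :=
  exists i, forall v, v \in \val P -> v 0 i = 0.

Definition Delta0 (K : fieldType) (P : P2 K) : Prop :=
  exists i : 'I_3, \val P = <[(delta_mx 0 i)%R]>%VS.

Definition coord_mul (K : fieldType) (u v : 'rV[K]_3) : 'rV[K]_3 :=
  \row_i (u 0 i * v 0 i).

Definition hadamard_defined (K : fieldType) (P Q : P2 K) : Prop :=
  exists i, vpick (\val P) 0 i * vpick (\val Q) 0 i != 0.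

(* vpick selects a nonzero vector; the choice is immaterial by               *)
(* hadamard_definedE and hadamardE. The value is P when the product is not   *)
(* defined.                                                                  *)
Definition hadamard (K : fieldType) (P Q : P2 K) : P2 K :=
  insubd P <[coord_mul (vpick (\val P)) (vpick (\val Q))]>%VS.

Section HadamardPoints.
Variable K : fieldType.
Implicit Types (P Q : P2 K) (u v : 'rV[K]_3).

Lemma P2_line P u : u \in \val P -> u != 0 -> \val P = <[u]>%VS.
Proof.
move=> uP u0; apply/esym/eqP.
by rewrite eqEdim -memvE uP dim_vline u0 (eqP (valP P)).
Qed.

Lemma P2_pick0 P : vpick (\val P) != 0.
Proof. by rewrite vpick0 -dimv_eq0 (eqP (valP P)). Qed.

Lemma P2_scale P u : u \in \val P -> u != 0 ->
  exists2 c, c != 0 & vpick (\val P) = c *: u.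
Proof.
move=> uP u0; have := memv_pick (\val P).
rewrite {2}(P2_line uP u0) => /vlineP[c pE]; exists c => //.
by apply: contraNneq (P2_pick0 P) => c0; rewrite pE c0 scale0r.
Qed.

Lemma coord_mulZ a b u v :
  coord_mul (a *: u) (b *: v) = (a * b) *: coord_mul u v.
Proof. by apply/rowP=> i; rewrite !mxE mulrACA. Qed.

Lemma hadamard_definedE P Q u v :
    u \in \val P -> u != 0 -> v \in \val Q -> v != 0 ->
  hadamard_defined P Q <-> exists i, u 0 i * v 0 i != 0.
Proof.
move=> uP u0 vQ v0.
have [a a0 aE] := P2_scale uP u0; have [b b0 bE] := P2_scale vQ v0.
rewrite /hadamard_defined aE bE; split=> -[i H]; exists i; move: H;
  by rewrite !mxE mulrACA !mulf_eq0 (negPf a0) (negPf b0).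
Qed.

Lemma hadamardE P Q u v : hadamard_defined P Q ->
    u \in \val P -> u != 0 -> v \in \val Q -> v != 0 ->
  \val (hadamard P Q) = <[coord_mul u v]>%VS.
Proof.
move=> dPQ uP u0 vQ v0.
have [i uvi] := (hadamard_definedE uP u0 vQ v0).1 dPQ.
have uv0 : coord_mul u v != 0.
  by apply: contraNneq uvi => /rowP/(_ i); rewrite !mxE => ->.
have [a a0 aE] := P2_scale uP u0; have [b b0 bE] := P2_scale vQ v0.
have ab0 : a * b != 0 by rewrite mulf_neq0.
rewrite /hadamard aE bE coord_mulZ val_insubd dim_vline scaler_eq0.
rewrite (negPf ab0) (negPf uv0) /=; apply/eqP.
rewrite eqEdim -memvE memvZ ?memv_line //= !dim_vline scaler_eq0.
by rewrite (negPf ab0) (negPf uv0).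
Qed.

Lemma not_Delta0_coord P i : ~ Delta0 P ->
  exists2 j, j != i & vpick (\val P) 0 j != 0.
Proof.
move=> nP; have p0 := P2_pick0 P.
case: (pickP (fun j => (j != i) && (vpick (\val P) 0 j != 0))).
  by move=> j /andP[]; exists j.
move=> H; case: nP; exists i.
have dE : vpick (\val P) = vpick (\val P) 0 i *: delta_mx 0 i.
  apply/rowP=> j; rewrite !mxE eqxx /=.
  have [->|ji] := eqVneq j i; first by rewrite mulr1.
  by rewrite mulr0; have := H j; rewrite ji /= => /negbFE/eqP.
apply: P2_line; last first.
  apply/eqP=> /rowP/(_ i); rewrite !mxE !eqxx => /eqP.
  by rewrite oner_eq0.
have pi0 : vpick (\val P) 0 i != 0.
  by apply: contraNneq p0 => p0; rewrite dE p0 scale0r.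
have := memv_pick (\val P); rewrite {1}dE => /(memvZ (vpick (\val P) 0 i)^-1).
by rewrite scalerA mulVf // scale1r.
Qed.

(* Outside Delta0 at least two coordinates are nonzero, so two such points   *)
(* share a nonzero coordinate.                                               *)
Lemma hadamard_defined_not_Delta0 P Q :
  ~ Delta0 P -> ~ Delta0 Q -> hadamard_defined P Q.
Proof.
move=> nP nQ.
have [i1 _ p1] := not_Delta0_coord ord0 nP.
have [i2 n12 p2] := not_Delta0_coord i1 nP.
have [k' kP] : exists k' : 'I_3, forall j, j != k' -> j = i1 \/ j = i2.
  have c2 : #|[set i1; i2]| = 2 by rewrite cards2 eq_sym n12.
  have : #|~: [set i1; i2]| == 1 by rewrite cardsCs setCK card_ord c2.
  case/cards1P=> k' /setP kE; exists k' => j jk.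
  have := kE j; rewrite !inE (negPf jk) => /negbFE /orP[]/eqP; by [left|right].
have [j jk qj] := not_Delta0_coord k' nQ.
by exists j; rewrite mulf_neq0 //; case: (kP j jk) => ->.
Qed.

End HadamardPoints.

(* Main.v *)
Require Import Defs.
From mathcomp Require Import all_boot all_order all_algebra.
From mathcomp Require Import mpoly ring zify.

(* Let E be the ideal whose trace on K[x] is the Hadamard product, and p, q   *)
(* coordinate vectors of P, Q with p_k, q_l nonzero. Modulo I(P)(y), I(Q)(z)  *)
(* and x_i - y_i z_i the vector x is (y_k z_l / (p_k q_l)) (p_i q_i)_i, so    *)
(* every form vanishing at P * Q lies in E when m = n = 1; multiplying out n  *)
(* such elements gives I(P * Q)^n inside I(P) * I(Q)^n. Conversely, for p     *)
(* with no zero coordinate, the specialization y = p, z = x / p maps E into   *)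
(* I(P * Q)^n, while y = t p, z = q handles the case m = n = 1 for any p. If  *)
(* p_i = 0 = q_j, then x_i^m and x_j^n lie in I(P)^m * I(Q)^n; since the      *)
(* coordinates have order 1 at P * Q, equality with I(P * Q)^(m + n - 1)      *)
(* forces m + n - 1 <= min(m, n), i.e. m = n = 1.                             *)

Set Implicit Arguments.
Unset Strict Implicit.
Unset Printing Implicit Defensive.

Import GRing.Theory.
Local Open Scope ring_scope.

(** Everything is computed by evaluating polynomials in other rings. By [ideal_ptP], f lies in I(P)
    exactly when f vanishes at the generic point X p of the line of P. Lower bounds on the Hadamard
    product come from [hadamard_sum_pt] (exponent 1) and [hadamard_sum_exp] (exponent n on the
    second factor). Upper bounds come from [ideal_hadamard_mmap], applied to a well-chosen point (u,
    v, w) with u_i = v_i w_i. Part (b) sets [var_ideal_hadamard] against the order bound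
    [var_ideal_exp]. *)

Definition is_ideal (R : comNzRingType) (I : R -> Prop) : Prop :=
  [/\ I 0, forall f g, I f -> I g -> I (f + g) & forall a f, I f -> I (a * f)].

(** * Generated ideals, sums and powers *)

Section Ideals.
Variable R : comNzRingType.
Implicit Types (G I J : R -> Prop) (f g a t : R).

Lemma ideal_sum I (T : eqType) (s : seq T) (F : T -> R) :
  is_ideal I -> (forall i, i \in s -> I (F i)) -> I (\sum_(i <- s) F i).
Proof. by case=> I0 ID _ sI; rewrite big_seq; elim/big_ind: _. Qed.

Lemma idealMr I f a : is_ideal I -> I f -> I (f * a).
Proof. by case=> _ _ IM If; rewrite mulrC; apply: IM. Qed.

Lemma zero_ideal : is_ideal (fun f : R => f = 0).
Proof. by split=> // [f g -> ->|a f ->]; rewrite ?addr0 ?mulr0. Qed.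

Lemma principal_ideal t : is_ideal (fun f => exists a, f = a * t).
Proof.
split=> [|_ _ [a ->] [b ->]|b _ [a ->]]; first by exists 0; rewrite mul0r.
  by exists (a + b); rewrite mulrDl.
by exists (b * a); rewrite mulrA.
Qed.

Lemma ideal_gen_ideal G : is_ideal (ideal_gen G).
Proof.
split=> [|_ _ [s1 s1G ->] [s2 s2G ->]|a _ [s sG ->]].
- by exists [::] => //; rewrite big_nil.
- exists (s1 ++ s2); last by rewrite big_cat.
  by move=> ag; rewrite mem_cat => /orP[]; [apply: s1G|apply: s2G].
- exists [seq (a * ag.1, ag.2) | ag <- s].
    by move=> _ /mapP[ag ags ->]; apply: (sG ag).
  by rewrite big_map mulr_sumr; apply: eq_bigr => ag _; rewrite mulrA.
Qed.

Lemma ideal_gen_in G f : G f -> ideal_gen G f.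
Proof.
move=> Gf; exists [:: (1, f)]; last by rewrite big_seq1 mul1r.
by move=> ag; rewrite inE => /eqP->.
Qed.

Lemma ideal_gen_sub G I : is_ideal I -> (forall f, G f -> I f) ->
  forall f, ideal_gen G f -> I f.
Proof.
move=> idI GI _ [s sG ->]; apply: ideal_sum => // ag /sG /GI.
by case: idI => _ _; apply.
Qed.

Lemma ideal_add_ideal I J :
  is_ideal I -> is_ideal J -> is_ideal (ideal_add I J).
Proof.
move=> [I0 ID IM] [J0 JD JM]; split.
- by exists 0, 0; rewrite addr0.
- move=> _ _ [f1 [g1 [If1 Jg1 ->]]] [f2 [g2 [If2 Jg2 ->]]].
  by exists (f1 + f2), (g1 + g2); rewrite addrACA; split; auto.
- move=> a _ [f [g [If Jg ->]]].
  by exists (a * f), (a * g); rewrite mulrDr; split; auto.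
Qed.

Lemma ideal_addl I J f : is_ideal J -> I f -> ideal_add I J f.
Proof. by case=> J0 _ _ If; exists f, 0; rewrite addr0. Qed.

Lemma ideal_addr I J f : is_ideal I -> J f -> ideal_add I J f.
Proof. by case=> I0 _ _ Jf; exists 0, f; rewrite add0r. Qed.

Lemma ideal_exp_ideal I n : is_ideal (ideal_exp I n).
Proof. exact: ideal_gen_ideal. Qed.

Lemma ideal_exp0 I f : ideal_exp I 0 f.
Proof.
rewrite -[f]mulr1; case: (ideal_exp_ideal I 0) => _ _; apply.
by apply: ideal_gen_in; exists [tuple] => //; rewrite big_nil.
Qed.

(** For fixed f, the g with f g in I^(n+1) form an ideal, so only products of n elements of I have
    to be tested. *)
Lemma ideal_expS_mul I n f g :
  I f -> ideal_exp I n g -> ideal_exp I n.+1 (f * g).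
Proof.
move=> If; have [E0 ED EM] := ideal_exp_ideal I n.+1.
apply: (ideal_gen_sub (I := fun g => ideal_exp I n.+1 (f * g))).
  split=> [|g1 g2|a g1 Ig]; rewrite ?mulr0 ?mulrDr //; first exact: ED.
  by rewrite mulrCA; apply: EM.
move=> _ [t tI ->]; apply: ideal_gen_in; exists [tuple of f :: t].
  by move=> h; rewrite inE => /predU1P[->|/tI].
by rewrite big_cons.
Qed.

Lemma ideal_expX I f n : I f -> ideal_exp I n (f ^+ n).
Proof.
move=> If; elim: n => [|n IHn]; first exact: ideal_exp0.
by rewrite exprS; apply: ideal_expS_mul.
Qed.

Lemma ideal_exp1 I : is_ideal I -> ideal_eq (ideal_exp I 1) I.
Proof.
move=> idI f; split; last by move/(ideal_expX 1); rewrite expr1.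
apply: (ideal_gen_sub idI) => _ [t tI ->].
case/tupleP: t tI => a t tI; rewrite tuple0 big_seq1; apply: tI.
exact: mem_head.
Qed.

(** For t = X in K[X], this turns membership in a power into an order of vanishing. *)
Lemma ideal_exp_principal t n f :
  ideal_exp (fun g => exists a, g = a * t) n f -> exists a, f = a * t ^+ n.
Proof.
apply: (ideal_gen_sub (principal_ideal (t ^+ n))) => _ [s sI ->].
elim: n s sI => [|n IHn] s; first by exists 1; rewrite tuple0 big_nil mulr1.
case/tupleP: s => g s sI; rewrite big_cons.
have [a ->] := sI g (mem_head _ _).
have [|b ->] := IHn s; first by move=> h hs; apply: sI; rewrite inE hs orbT.
by exists (a * b); rewrite mulrACA -exprS.
Qed.

End Ideals.

(** * Ideals and ring morphisms *)

Section IdealMorphism.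
Variables (R S : comNzRingType) (phi : {rmorphism R -> S}).
Implicit Types (I : R -> Prop) (J : S -> Prop).

Lemma ideal_preim J : is_ideal J -> is_ideal (fun f => J (phi f)).
Proof.
case=> J0 JD JM; split=> [|f g|a f]; rewrite ?rmorph0 ?rmorphD ?rmorphM //.
  exact: JD.
exact: JM.
Qed.

Lemma ideal_exp_morph I J n f : (forall g, I g -> J (phi g)) ->
  ideal_exp I n f -> ideal_exp J n (phi f).
Proof.
move=> IJ.
apply: (ideal_gen_sub (ideal_preim (ideal_exp_ideal J n))) => _ [t tI ->].
apply: ideal_gen_in; exists [tuple of map phi t].
  by move=> _ /mapP[g /tI /IJ Jg ->].
by rewrite rmorph_prod big_map.
Qed.

End IdealMorphism.

(** * Evaluation of polynomials in a ring *)

Lemma rmorph_mmap (n : nat) (R S T : comNzRingType)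
    (phi : {rmorphism S -> T}) (c : R -> S) (u : 'I_n -> S) p :
  phi (mmap c u p) = mmap (phi \o c) (phi \o u) p.
Proof.
rewrite rmorph_sum; apply: eq_bigr => m _; rewrite rmorphM rmorph_prod.
by congr (_ * _); apply: eq_bigr => i _; rewrite rmorphXn.
Qed.

Section Mmap.
Variables (n : nat) (R S : comNzRingType).
Implicit Types (c : {rmorphism R -> S}) (u v : 'I_n -> S) (p : {mpoly R[n]}).

Lemma eq_mmap (c c' : R -> S) u v p :
  c =1 c' -> u =1 v -> mmap c u p = mmap c' v p.
Proof.
by move=> cc' uv; apply: eq_bigr => m _; rewrite cc' (mmap1_eq _ uv).
Qed.

Lemma mmap_meval c (a : 'I_n -> R) p : mmap c (c \o a) p = c p.@[a].
Proof. by rewrite /meval (rmorph_mmap c). Qed.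

Lemma mmap_dhomog d c (t : S) u p : p \is d.-homog ->
  mmap c (fun i => t * u i) p = t ^+ d * mmap c u p.
Proof.
move=> /dhomogP hp; rewrite /mmap mulr_sumr !big_seq; apply: eq_bigr => m mp.
rewrite mulrCA; congr (_ * _); have /= dE := hp m mp; rewrite /mmap1 -dE mdegE.
by rewrite -prodrXr -big_split; apply: eq_bigr => i _; rewrite exprMn.
Qed.

(** Congruence modulo an ideal respects sums and products, hence polynomial evaluation. *)
Lemma mmap_congr (I : S -> Prop) c u v p : is_ideal I ->
  (forall i, I (u i - v i)) -> I (mmap c u p - mmap c v p).
Proof.
move=> idI Iuv; have [I0 ID IM] := idI.
have IMM a b a' b' : I (a - a') -> I (b - b') -> I (a * b - a' * b').
  move=> Ia Ib; have -> : a * b - a' * b' = b * (a - a') + a' * (b - b').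
    by rewrite !mulrBr [b * a]mulrC [b * a']mulrC addrA subrK.
  by apply: ID; apply: IM.
rewrite /mmap -sumrB; apply: ideal_sum => // m _; rewrite -mulrBr; apply: IM.
apply: (big_ind2 (fun a b => I (a - b))) => [||i _]; rewrite ?subrr //.
  by move=> a b a' b' *; apply: IMM.
by elim: (m i) => [|k IHk]; rewrite ?expr0 ?subrr // !exprS; apply: IMM.
Qed.

End Mmap.

(** * The ideal of a point *)

Section Points.
Variable K : fieldType.
Implicit Types (P Q : P2 K) (p q : 'rV[K]_3) (f : {mpoly K[3]}).

(** On a form of degree d the scalar t comes out as t^d, leaving the image of its value at p, which
    is 0. The ring S is arbitrary because t will be 1, an indeterminate, or an expression in y and
    z. *)
Lemma ideal_pt_mmap (S : comNzRingType) (c : {rmorphism K -> S}) (t : S) P p f :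
    p \in \val P -> ideal_pt P f ->
  mmap c (fun i => t * c (p 0 i)) f = 0.
Proof.
move=> pP; pose phi : {rmorphism _ -> S} := mmap c (fun i => t * c (p 0 i)).
apply: (ideal_gen_sub (ideal_preim phi (@zero_ideal S))) => g.
case=> -[d gd] gP /=.
by rewrite (mmap_dhomog _ _ _ gd) (mmap_meval c) gP // rmorph0 mulr0.
Qed.

Lemma dhomog_ideal_pt d P p f : p \in \val P -> p != 0 ->
  f \is d.-homog -> f.@[p 0] = 0 -> ideal_pt P f.
Proof.
move=> pP p0 fd fp; apply: ideal_gen_in; split=> [|v]; first by exists d.
rewrite (P2_line pP p0) => /vlineP[a ->].
have -> : f.@[(a *: p) 0] = mmap idfun (fun i => a * p 0 i) f.
  by apply: eq_mmap => // i; rewrite mxE.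
by rewrite (mmap_dhomog _ _ _ fd) [mmap _ _ _]fp mulr0.
Qed.

(** The coefficient of X^d in f(X p) is the value at p of the degree d component of f, so f(X p) = 0
    says that every component vanishes at P. *)
Lemma ideal_ptP P p f : p \in \val P -> p != 0 ->
  ideal_pt P f <-> mmap polyC (fun i => 'X * (p 0 i)%:P) f = 0.
Proof.
move=> pP p0; split=> [|f0]; first exact: (ideal_pt_mmap polyC 'X pP).
pose k := mmeasure mdeg f.
have fE := pihomog_partitionE (leqnn k); rewrite -/k in fE.
suff fp d : (pihomog mdeg d f).@[p 0] = 0.
  rewrite fE; apply: ideal_sum => [|i _]; first exact: ideal_gen_ideal.
  by apply: (dhomog_ideal_pt pP p0 (pihomogP mdeg i f)).
(* The measure k strictly exceeds every degree in f, so the components of degree at least k are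
   zero. *)
have [dk|kd] := ltnP d k; last first.
  suff -> : pihomog mdeg d f = 0 by rewrite meval0.
  rewrite fE (linear_sum (pihomog mdeg d)) big1 // => i _ /=.
  rewrite (@pihomog_ne0 _ _ mdeg i) ?pihomogP //.
  by rewrite ltn_eqF // (leq_trans (ltn_ord i)).
move/(congr1 (fun g : {poly K} => g`_d)): f0.
rewrite fE raddf_sum coef0 coef_sum (bigD1 (Ordinal dk)) //= big1 => [|i id].
  rewrite addr0 (mmap_dhomog _ _ _ (pihomogP mdeg _ _)) (mmap_meval polyC).
  by rewrite coefXnM ltnn subnn coefC eqxx -fE.
rewrite (mmap_dhomog _ _ _ (pihomogP mdeg _ _)) (mmap_meval polyC).
rewrite mulrC coefCM coefXn (_ : (d == i) = false) ?mulr0 //.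
by apply: contra_neqF id => /eqP di; apply: val_inj.
Qed.

(* On the line t |-> p + t e_i the elements of I(P) vanish at t = 0, while   *)
(* x_i becomes t.                                                            *)
Lemma var_ideal_exp P p i m n : p \in \val P -> p 0 i = 0 ->
  ideal_exp (ideal_pt P) n ('X_i ^+ m) -> (n <= m)%N.
Proof.
move=> pP pi0.
pose u j : {poly K} := (p 0 j)%:P + (j == i)%:R * 'X.
pose phi : {rmorphism {mpoly K[3]} -> {poly K}} := mmap polyC u.
have phiP g : ideal_pt P g -> exists a, phi g = a * 'X.
  move=> gP.
  have : 'X %| phi g.
    rewrite -['X]subr0 -polyC0 dvdp_XsubCl /root.
    have -> : (phi g).[0] = mmap idfun (fun j => 1 * p 0 j) g.
      rewrite -[_.[0]]/(horner_eval 0 _) rmorph_mmap; apply: eq_mmap => j /=.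
        by rewrite /horner_eval hornerC.
      by rewrite /horner_eval /u !hornerE.
    by rewrite (ideal_pt_mmap idfun 1 pP).
  by move=> /dvdpP.
move=> /(ideal_exp_morph phiP)/ideal_exp_principal[a].
rewrite rmorphXn /= mmapX mmap1U /u pi0 eqxx polyC0 add0r mul1r => aE.
have : 'X^n %| ('X^m : {poly K}) by rewrite aE dvdp_mull.
by rewrite dvdp_Pexp2l ?size_polyX.
Qed.

End Points.

(** * The ideal defining the Hadamard product, before elimination *)

Section Hadamard.
Variable K : fieldType.
Implicit Types (P Q R : P2 K) (A B : {mpoly K[3]} -> Prop).
Implicit Types (f g : {mpoly K[3]}) (p q : 'rV[K]_3).

Lemma substE (v : 'I_3 -> Sxyz K) f : subst v f = mmap (@mpolyC _ K) v f.
Proof. by apply: eq_mmap => // i; rewrite tnth_mktuple. Qed.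

(** This is the ideal E, kept in K[x, y, z] because the computations multiply by elements involving
    y and z. *)
Definition hadamard_sum A B : Sxyz K -> Prop :=
  ideal_add (ideal_add (ideal_ext (@yvar K) A) (ideal_ext (@zvar K) B))
    (@graph_ideal K).

Lemma hadamard_sum_ideal A B : is_ideal (hadamard_sum A B).
Proof.
by apply: ideal_add_ideal; [apply: ideal_add_ideal|]; apply: ideal_gen_ideal.
Qed.

Lemma hadamard_sum_y A B F :
  ideal_ext (@yvar K) A F -> hadamard_sum A B F.
Proof. by move=> yF; do 2!apply: ideal_addl (ideal_gen_ideal _) _. Qed.

Lemma hadamard_sum_z A B F :
  ideal_ext (@zvar K) B F -> hadamard_sum A B F.
Proof.
by move=> zF; apply/ideal_addl/ideal_addr => //; apply: ideal_gen_ideal.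
Qed.

Lemma hadamard_sum_graph A B i :
  hadamard_sum A B (xvar K i - yvar K i * zvar K i).
Proof.
apply: ideal_addr; last by apply: ideal_gen_in; exists i.
by apply: ideal_add_ideal; apply: ideal_gen_ideal.
Qed.

Lemma ideal_ext_in (v : 'I_3 -> Sxyz K) A f : A f -> ideal_ext v A (subst v f).
Proof. by move=> Af; apply: ideal_gen_in; exists f. Qed.

Lemma ideal_ext_mul (v : 'I_3 -> Sxyz K) A B C F G :
    (forall f g, A f -> B g -> C (f * g)) ->
  ideal_ext v A F -> ideal_ext v B G -> ideal_ext v C (F * G).
Proof.
move=> ABC AF BG; have [C0 CD CM] : is_ideal (ideal_ext v C).
  exact: ideal_gen_ideal.
move: F AF; apply: ideal_gen_sub => [|_ [f Af ->]].
  split=> [|F1 F2|a F]; rewrite ?mul0r ?mulrDl -?mulrA //; first exact: CD.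
  exact: CM.
move: G BG; apply: ideal_gen_sub => [|_ [g Bg ->]].
  split=> [|F1 F2|a F]; rewrite ?mulr0 ?mulrDr //; first exact: CD.
  by rewrite mulrCA; apply: CM.
by rewrite /subst -rmorphM; apply: ideal_ext_in; apply: ABC.
Qed.

Lemma eq_ideal_hadamard A A' B B' : ideal_eq A A' -> ideal_eq B B' ->
  ideal_eq (ideal_hadamard A B) (ideal_hadamard A' B').
Proof.
have ext (v : 'I_3 -> Sxyz K) C D F :
    ideal_eq C D -> ideal_ext v C F <-> ideal_ext v D F.
  move=> CD; split; apply: (ideal_gen_sub (ideal_gen_ideal _)) => _ [f Cf ->];
    by apply: ideal_ext_in; apply/CD.
move=> AA' BB' f; rewrite /ideal_hadamard.
split=> -[_ [h [[a [b [Aa Bb ->]]] hG ->]]]; exists (a + b), h; split=> //;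
  by exists a, b; split=> //; [apply/(ext _ _ _ _ AA')|apply/(ext _ _ _ _ BB')].
Qed.

(** * Evaluation at a point of the graph x_i = y_i z_i *)

Section Eval.
Variables (S : comNzRingType) (c : {rmorphism K -> S}) (u v w : 'I_3 -> S).

Definition xyz_val (i : 'I_(3 + 3 + 3)) : S :=
  match split i with
  | inl j => match split j with inl k => u k | inr k => v k end
  | inr k => w k
  end.

Lemma mmap_subst (s : 'I_3 -> Sxyz K) f :
  mmap c xyz_val (subst s f) = mmap c (mmap c xyz_val \o s) f.
Proof.
by rewrite substE rmorph_mmap; apply: eq_mmap => // a; apply: mmapC.
Qed.

Lemma mmap_xvar i : mmap c xyz_val (xvar K i) = u i.
Proof.
by rewrite mmapX mmap1U /xyz_val (unsplitK (inl _)) (unsplitK (inl _)).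
Qed.

Lemma mmap_yvar i : mmap c xyz_val (yvar K i) = v i.
Proof.
by rewrite mmapX mmap1U /xyz_val (unsplitK (inl _)) (unsplitK (inr _)).
Qed.

Lemma mmap_zvar i : mmap c xyz_val (zvar K i) = w i.
Proof. by rewrite mmapX mmap1U /xyz_val (unsplitK (inr _)). Qed.

(** Evaluation at (u, v, w) kills the graph ideal because u_i = v_i w_i, and sends the extensions of
    A and B into J; so it sends all of E into J. *)
Lemma ideal_hadamard_mmap (J : S -> Prop) A B f : is_ideal J ->
    (forall i, u i = v i * w i) ->
    (forall g, A g -> J (mmap c v g)) -> (forall g, B g -> J (mmap c w g)) ->
  ideal_hadamard A B f -> J (mmap c u f).
Proof.
move=> idJ uvw AJ BJ.
have idpre := ideal_preim (mmap c xyz_val) idJ; have [_ JD _] := idJ.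
have -> : mmap c u f = mmap c xyz_val (subst (@xvar K) f).
  by rewrite mmap_subst; apply: eq_mmap => // i; rewrite /= mmap_xvar.
move=> [_ [h [[a [b [Aa Bb ->]]] hG ->]]].
rewrite !rmorphD; apply: (JD); first apply: (JD).
- apply: (ideal_gen_sub idpre) Aa => _ [g /AJ Jg ->].
  rewrite /= mmap_subst (eq_mmap (c' := c) (v := v)) // => i.
  exact: mmap_yvar.
- apply: (ideal_gen_sub idpre) Bb => _ [g /BJ Jg ->].
  rewrite /= mmap_subst (eq_mmap (c' := c) (v := w)) // => i.
  exact: mmap_zvar.
- apply: (ideal_gen_sub idpre) hG => _ [i ->].
  rewrite rmorphB rmorphM /= mmap_xvar mmap_yvar mmap_zvar uvw subrr.
  by case: idJ.
Qed.

End Eval.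

(** * Elements of the Hadamard product *)

Lemma ideal_ext_proportional (v : 'I_3 -> Sxyz K) P p i k :
    p \in \val P -> p != 0 -> p 0 k != 0 ->
  ideal_ext v (ideal_pt P) (v i - (p 0 i / p 0 k)%:MP * v k).
Proof.
move=> pP p0 pk.
have -> : v i - (p 0 i / p 0 k)%:MP * v k =
    subst v ('X_i - (p 0 i / p 0 k) *: 'X_k).
  by rewrite substE rmorphB /= mmapZ !mmapX !mmap1U.
apply: ideal_ext_in; apply: (@dhomog_ideal_pt _ 1 _ _ _ pP p0).
  by rewrite rpredB ?rpredZ // dhomogX /= mdeg1.
by rewrite mevalB mevalZ !mevalXU divfK // subrr.
Qed.

Lemma nz_coord p : p != 0 -> exists i, p 0 i != 0.
Proof.
by move=> /eqP p0; apply/existsP; apply: contra_notT p0 => /existsPn pi0;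
  apply/rowP=> i; rewrite mxE; apply/eqP/negbNE/pi0.
Qed.

Lemma hadamard_sum_pt P Q R p q f :
    p \in \val P -> p != 0 -> q \in \val Q -> q != 0 ->
    coord_mul p q \in \val R ->
  ideal_pt R f ->
  hadamard_sum (ideal_pt P) (ideal_pt Q) (subst (@xvar K) f).
Proof.
move=> pP p0 qQ q0 pqR fR.
have [k pk] := nz_coord p0; have [l ql] := nz_coord q0.
have idH := hadamard_sum_ideal (ideal_pt P) (ideal_pt Q); have [_ HD HM] := idH.
(* Modulo E, y_i is (p_i / p_k) y_k and z_i is (q_i / q_l) z_l, hence x_i = y_i z_i becomes t p_i
   q_i. *)
pose t : Sxyz K := yvar K k * zvar K l * ((p 0 k)^-1 * (q 0 l)^-1)%:MP.
rewrite substE -[mmap _ _ _]subr0.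
(* The subtracted 0 is the value of f at t (p_i q_i)_i, so that [mmap_congr] reduces the goal to the
   coordinates. *)
rewrite -(ideal_pt_mmap (@mpolyC _ K) t pqR fR).
apply: mmap_congr => // i.
have -> : xvar K i - t * (coord_mul p q 0 i)%:MP =
    xvar K i - yvar K i * zvar K i
    + (zvar K i * (yvar K i - (p 0 i / p 0 k)%:MP * yvar K k)
    + (p 0 i / p 0 k)%:MP * yvar K k
      * (zvar K i - (q 0 i / q 0 l)%:MP * zvar K l)).
  by rewrite /t mxE !mpolyCM; ring.
apply: (HD); first exact: hadamard_sum_graph.
by apply: (HD); apply: (HM); [apply: hadamard_sum_y|apply: hadamard_sum_z];
  apply: ideal_ext_proportional.
Qed.

(** Each factor is a sum of a part from A(y), a part from B(z) and a graph part. In the expanded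
    product only the pure B(z) term needs the exponent n, while A stays at exponent 1. *)
Lemma hadamard_sum_exp A B C n f :
    (forall g, C g -> hadamard_sum A B (subst (@xvar K) g)) ->
  ideal_exp C n f -> hadamard_sum A (ideal_exp B n) (subst (@xvar K) f).
Proof.
move=> CAB.
pose phi : {rmorphism {mpoly K[3]} -> Sxyz K} :=
  mmap (@mpolyC _ K) (@xvar K).
have phiE g : subst (@xvar K) g = phi g by apply: substE.
rewrite phiE; move: f.
apply: ideal_gen_sub => [|_ [t tC ->]].
  exact: (ideal_preim phi (hadamard_sum_ideal _ _)).
elim: n t tC => [|n IHn] t.
  rewrite tuple0 big_nil rmorph1 => _; apply: hadamard_sum_z.
  rewrite -[1](comp_mpoly1 [tuple zvar K i | i < 3]).
  by apply: ideal_ext_in; apply: ideal_exp0.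
case/tupleP: t => g t tC; rewrite big_cons rmorphM.
have /CAB := tC g (mem_head _ _); rewrite phiE.
have /IHn : forall h, h \in t -> C h.
  by move=> h ht; apply: tC; rewrite inE ht orbT.
move: (phi g) (phi _) => G F {tC CAB}.
have idH := hadamard_sum_ideal A (ideal_exp B n.+1); have [_ HD HM] := idH.
move=> [_ [h [[a [b [Aa Bb ->]]] hG ->]]].
move=> [_ [h' [[a' [b' [Aa' Bb' ->]]] hG' ->]]].
have hy a0 : ideal_ext (@yvar K) A a0 -> hadamard_sum A (ideal_exp B n.+1) a0.
  exact: hadamard_sum_y.
have hg h0 : graph_ideal h0 -> hadamard_sum A (ideal_exp B n.+1) h0.
  by apply: ideal_gen_sub => // _ [i ->]; apply: hadamard_sum_graph.
(* In (a' + b' + h') (a + b + h) every term except b' b has a factor in A(y) or in the graph ideal;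
   b' b lies in the extension of B^(n+1). *)
rewrite mulrDl; apply: (HD); last by apply: idealMr => //; apply: hg.
rewrite mulrDl; apply: (HD); first by apply: idealMr => //; apply: hy.
rewrite mulrDr; apply: (HD); last by apply: (HM); apply: hg.
rewrite mulrDr; apply: (HD); first by apply: (HM); apply: hy.
apply: hadamard_sum_z; apply: ideal_ext_mul Bb' Bb.
exact: ideal_expS_mul.
Qed.

(** Modulo the graph ideal x_i^m is y_i^m z_i^m, and one factor in E is enough. *)
Lemma var_ideal_hadamard A B i m :
    A ('X_i ^+ m) \/ B ('X_i ^+ m) -> ideal_hadamard A B ('X_i ^+ m).
Proof.
move=> AB; have idH := hadamard_sum_ideal A B; have [_ HD HM] := idH.
have sE (s : 'I_3 -> Sxyz K) : subst s ('X_i ^+ m) = s i ^+ m.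
  by rewrite substE rmorphXn /= mmapX mmap1U.
change (hadamard_sum A B (subst (@xvar K) ('X_i ^+ m))).
rewrite sE -[xvar K i ^+ m](subrK ((yvar K i * zvar K i) ^+ m)).
apply: (HD); first by rewrite subrXX; apply: idealMr => //;
  apply: hadamard_sum_graph.
rewrite exprMn -!sE; case: AB => XI; last first.
  by apply: (HM); apply: hadamard_sum_z; apply: ideal_ext_in.
by apply: idealMr => //; apply: hadamard_sum_y; apply: ideal_ext_in.
Qed.

Lemma var_ideal_pt P p i : p \in \val P -> p != 0 -> p 0 i = 0 ->
  ideal_pt P 'X_i.
Proof.
move=> pP p0 pi0; apply: (@dhomog_ideal_pt _ 1 _ _ _ pP p0).
  by rewrite dhomogX /= mdeg1.
by rewrite mevalXU.
Qed.

Lemma Delta1P P p : p \in \val P -> p != 0 ->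
  Delta1 P <-> exists i, p 0 i = 0.
Proof.
move=> pP p0; split=> -[i pi0]; exists i; first exact: pi0.
by move=> v; rewrite (P2_line pP p0) => /vlineP[a ->]; rewrite mxE pi0 mulr0.
Qed.

(** * The two equalities for points with a nonzero product vector *)

Section Pair.
Variables (P Q R : P2 K) (p q : 'rV[K]_3).
Hypotheses (pP : p \in \val P) (p0 : p != 0) (qQ : q \in \val Q) (q0 : q != 0).
Hypotheses (pqR : coord_mul p q \in \val R) (pq0 : coord_mul p q != 0).

Lemma ideal_exp_sub_hadamard n f : ideal_exp (ideal_pt R) n f ->
  ideal_hadamard (ideal_pt P) (ideal_exp (ideal_pt Q) n) f.
Proof.
by apply: hadamard_sum_exp => g; apply: hadamard_sum_pt pP p0 qQ q0 pqR.
Qed.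

Lemma ideal_hadamard_exp n : (forall i, p 0 i != 0) ->
  ideal_eq (ideal_hadamard (ideal_pt P) (ideal_exp (ideal_pt Q) n))
           (ideal_exp (ideal_pt R) n).
Proof.
move=> pn0 f; split; last exact: ideal_exp_sub_hadamard.
(* The specialization y = p, z = x / p lies on the graph over x itself; the factor 1 is the scalar t
   of [ideal_pt_mmap]. *)
pose v i : {mpoly K[3]} := 1 * (p 0 i)%:MP.
pose w i : {mpoly K[3]} := (p 0 i)^-1%:MP * 'X_i.
have fE : mmap (@mpolyC _ K) (fun i => 'X_i) f = f.
  rewrite -[RHS]comp_mpoly_id; apply: eq_mmap => // i.
  by rewrite tnth_mktuple.
rewrite -[in X in _ -> X]fE.
apply: (ideal_hadamard_mmap (v := v) (w := w)) => [|i|g gP|g].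
- exact: ideal_exp_ideal.
- by rewrite /v /w mul1r mulrA -mpolyCM divff // mul1r.
- rewrite /v (ideal_pt_mmap _ _ pP gP).
  by case: (ideal_exp_ideal (ideal_pt R) n).
pose phi : {rmorphism {mpoly K[3]} -> {mpoly K[3]}} := mmap (@mpolyC _ K) w.
apply: (ideal_exp_morph (phi := phi)) => {}g gQ.
(* Dividing the coordinates of X (p_i q_i)_i by p_i gives X q, where elements of I(Q) vanish. *)
apply/(ideal_ptP _ pqR pq0); rewrite -(ideal_pt_mmap polyC 'X qQ gQ).
rewrite rmorph_mmap; apply: eq_mmap => i /=; first by rewrite mmapC.
rewrite /w rmorphM /= mmapC mmapX mmap1U mxE polyCM.
by rewrite mulrCA [_%:P * (_ * _)]mulrA -polyCM mulVf // mul1r.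
Qed.

Lemma ideal_hadamard_pt :
  ideal_eq (ideal_hadamard (ideal_pt P) (ideal_pt Q)) (ideal_pt R).
Proof.
move=> f; split; last exact: hadamard_sum_pt pP p0 qQ q0 pqR.
(* Only one factor carries X, so x becomes the generic point X (p_i q_i)_i required by
   [ideal_ptP]. *)
pose v i : {poly K} := 'X * (p 0 i)%:P; pose w i : {poly K} := 1 * (q 0 i)%:P.
move=> H; apply/(ideal_ptP _ pqR pq0); move: H.
apply: (@ideal_hadamard_mmap _ polyC _ v w (fun a => a = 0)) => [|i|g gP|g gQ].
- exact: zero_ideal.
- by rewrite /v /w mul1r mxE polyCM mulrA.
- exact: ideal_pt_mmap gP.
- exact: ideal_pt_mmap gQ.
Qed.

End Pair.
End Hadamard.

Theorem proposition4p4 (K : closedFieldType) (P Q : P2 K) :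
  (~ Delta1 P -> hadamard_defined P Q ->
     forall n : nat, (1 <= n)%N ->
       ideal_eq (ideal_hadamard (ideal_exp (ideal_pt P) 1) (ideal_exp (ideal_pt Q) n))
                (ideal_exp (ideal_pt (hadamard P Q)) (1 + n - 1)%N) /\
       ideal_eq (ideal_hadamard (ideal_pt P) (ideal_exp (ideal_pt Q) n))
                (ideal_exp (ideal_pt (hadamard P Q)) n)) /\
  (Delta1 P -> ~ Delta0 P -> Delta1 Q -> ~ Delta0 Q ->
     forall m n : nat, (1 <= m)%N -> (1 <= n)%N ->
       ideal_eq (ideal_hadamard (ideal_exp (ideal_pt P) m) (ideal_exp (ideal_pt Q) n))
                (ideal_exp (ideal_pt (hadamard P Q)) (m + n - 1)%N)
       <-> m = 1%N /\ n = 1%N).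
Proof.
set R := hadamard P Q.
have pP := memv_pick (\val P); have p0 := P2_pick0 P.
have qQ := memv_pick (\val Q); have q0 := P2_pick0 Q.
set p := vpick (\val P) in pP p0; set q := vpick (\val Q) in qQ q0.
have pqR : hadamard_defined P Q ->
    coord_mul p q \in \val R /\ coord_mul p q != 0.
  move=> dPQ; rewrite (hadamardE dPQ pP p0 qQ q0) memv_line; split=> //.
  have [i] := (hadamard_definedE pP p0 qQ q0).1 dPQ.
  by apply: contraNneq => /rowP/(_ i); rewrite !mxE => ->.
have exp1 (T : P2 K) : ideal_eq (ideal_exp (ideal_pt T) 1) (ideal_pt T).
  exact/ideal_exp1/ideal_gen_ideal.
split=> [nP /pqR[rR r0] n _ | dP nP dQ nQ m n m0 n0].
  have pn0 i : p 0 i != 0.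
    by apply/eqP => pi0; apply: nP; apply/(Delta1P pP p0); exists i.
  have eqn := ideal_hadamard_exp pP p0 qQ q0 rR r0 n pn0.
  split=> // f; rewrite addKn; apply: iff_trans (eqn f).
  exact: (eq_ideal_hadamard (exp1 P) (fun _ => iff_refl _)).
have [rR r0] := pqR (hadamard_defined_not_Delta0 nP nQ).
have [i pi0] := (Delta1P pP p0).1 dP; have [j qj0] := (Delta1P qQ q0).1 dQ.
split=> [mnE | [-> ->] f].
  (* As p_i = 0, x_i^m lies in I(P)^m and hence in the left side; the assumed equality puts it in
     I(R)^(m+n-1), where [var_ideal_exp] bounds the exponent. The same with q_j = 0 bounds it by
     n. *)
  have le_m : (m + n - 1 <= m)%N.
    apply: (@var_ideal_exp _ R (coord_mul p q) i) => //.
      by rewrite mxE pi0 mul0r.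
    apply/mnE/var_ideal_hadamard; left; apply: ideal_expX.
    exact: var_ideal_pt pi0.
  have le_n : (m + n - 1 <= n)%N.
    apply: (@var_ideal_exp _ R (coord_mul p q) j) => //.
      by rewrite mxE qj0 mulr0.
    apply/mnE/var_ideal_hadamard; right; apply: ideal_expX.
    exact: var_ideal_pt qj0.
  by clear -le_m le_n m0 n0; lia.
apply: iff_trans (eq_ideal_hadamard (exp1 P) (exp1 Q) f) _.
apply: iff_trans (ideal_hadamard_pt pP p0 qQ q0 rR r0 f) _.
exact: iff_sym (exp1 R f).
Qed.
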